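(* Let $D_{1,+},D_{1,-}$ form a periodic first-derivative upwind SBP operator, $D_1$ a periodic first-derivative SBP operator and $D_2$ a periodic second-derivative SBP operator, all on the same grid with $N$ nodes and with the same diagonal mass matrix $M$. Let $g>0$, let $\boldsymbol b\in\mathbb R^N$ be the bathymetry vector (constant in time), and let $\boldsymbol{\hat\alpha},\boldsymbol{\hat\beta},\boldsymbol{\hat\gamma}\in\mathbb R^N$ be the coefficient vectors given in the context. Consider the semidiscretization for $\boldsymbol h(t),\boldsymbol v(t)\in\mathbb R^N$ with $\boldsymbol h>0$ componentwise and $\boldsymbol P=\boldsymbol h\boldsymbol v$: $$\boldsymbol h_t=-D_1(\boldsymbol h\boldsymbol v)+D_{1,-}\boldsymbol y,$$ $$\begin{aligned}(\boldsymbol h\boldsymbol v)_t={}&-\tfrac12\big(D_1(\boldsymbol h\boldsymbol v^2)+\boldsymbol h\boldsymbol vD_1\boldsymbol v+\boldsymbol vD_1(\boldsymbol h\boldsymbol v)\big)-g\boldsymbol hD_1(\boldsymbol h+\boldsymbol b)\\&+\tfrac12\big(D_{1,-}(\boldsymbol v\boldsymbol y)+\boldsymbol vD_{1,-}\boldsymbol y+\boldsymbol yD_{1,+}\boldsymbol v\big)+D_{1,+}(\boldsymbol{\hat\beta}D_{1,-}\boldsymbol v_t)+\tfrac12D_2(\boldsymbol{\hat\gamma}D_1\boldsymbol v)+\tfrac12D_1(\boldsymbol{\hat\gamma}D_2\boldsymbol v),\end{aligned}$$ where $\boldsymbol y=\boldsymbol{\hat\alpha}D_{1,-}(\boldsymbol{\hat\alpha}D_{1,+}(\boldsymbol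 h+\boldsymbol b))$. Then, along every solution: (1) the total mass $\mathcal M(t)=\boldsymbol 1^TM\boldsymbol h$ is conserved; (2) if the bathymetry is constant ($\boldsymbol b=b_0\boldsymbol 1$), the total discharge $\mathcal I(t)=\boldsymbol 1^TM\boldsymbol P$ is conserved; (3) the scheme is entropy-stable in terms of the modified entropy, i.e. $$\frac{d}{dt}\hat{\mathcal E}(t)\le0,\qquad \hat{\mathcal E}(t)=\boldsymbol 1^TM\Big(\tfrac12(\boldsymbol h\boldsymbol v^2+g\boldsymbol h^2)+g\boldsymbol h\boldsymbol b+\tfrac12\boldsymbol{\hat\beta}(D_1\boldsymbol v)^2\Big).$$ Moreover, (4) the scheme is well-balanced: every lake-at-rest state $\boldsymbol v=\boldsymbol 0$, $\boldsymbol h+\boldsymbol b=c\,\boldsymbol 1$ with $c\in\mathbb R$ (and $\boldsymbol h>0$) is a stationary solution.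
   Context: Products and powers of vectors in $\mathbb R^N$ are taken componentwise: $(\boldsymbol u\boldsymbol v)_j=u_jv_j$, $(\boldsymbol u^k)_j=u_j^k$; expressions such as $\boldsymbol vD_{1,-}\boldsymbol y$ mean the componentwise product of $\boldsymbol v$ and $D_{1,-}\boldsymbol y$. $\boldsymbol 1=(1,\dots,1)^T$, $\boldsymbol 0=(0,\dots,0)^T$. ''Conserved'' means that the time derivative vanishes along every (continuously differentiable in time) solution. A derivative matrix $A\in\mathbb R^{N\times N}$ is consistent if $A\boldsymbol 1=\boldsymbol 0$. A periodic first-derivative SBP (summation-by-parts) operator consists of a grid $\boldsymbol x$, a consistent first-derivative matrix $D_1$ and a symmetric positive-definite matrix $M$ with $MD_1+D_1^TM=0$. A periodic first-derivative upwind SBP operator consists of a grid $\boldsymbol x$, consistent first-derivative matrices $D_{1,\pm}$ and a symmetric positive-definite matrix $M$ such that $MD_{1,+}+D_{1,-}^TM=0$ and $\frac12M(D_{1,+}-D_{1,-})$ is negative semidefinite. A periodic second-derivative SBP operator consists of a grid $\boldsymbol x$, a consistent second-derivative matrix $D_2$ and a symmetric positive-definite matrix $M$ with $MD_2=D_2^TM$. Throughout, $M$ is diagonal. Coefficients: with still water depth $\boldsymbol D=\eta_0\boldsymbol 1-\boldsymbol b$ (componentwise positive) for a reference height $\eta_0$ and parameters $\tilde\alpha\ge0$, $\tilde\beta,\tilde\gamma\in\mathbb R$, the real vectors $\boldsymbol{\hat\alpha},\boldsymbol{\hat\beta},\boldsymbol{\hat\gamma}$ satisfy componentwise $\boldsymbol{\hat\alpha}^2=\tilde\alpha\sqrt{g\boldsymbol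 D}\,\boldsymbol D^2$, $\boldsymbol{\hat\beta}=\tilde\beta\boldsymbol D^3$, $\boldsymbol{\hat\gamma}=\tilde\gamma\sqrt{g\boldsymbol D}\,\boldsymbol D^3$. These are constant in time. The system is a semidiscretization, with periodic boundary conditions, of the dispersive shallow water model of Svärd and Kalisch, with water height $h$, velocity $v$, bathymetry $b$.
   Formalization: In (3) the term ½β̂(D_1 v)² of the modified entropy is replaced by ½β̂(D_{1,-} v)², because with D_1 the entropy inequality is false in general; the two agree when D_{1,±} = D_1. *)

(* Defs.v *)
(* MathComp / MathComp-Analysis *)
From HB Require Import structures.
From mathcomp Require Import all_boot all_order all_algebra.
From mathcomp Require Import all_classical all_reals all_analysis.
Import Order.TTheory GRing.Theory Num.Theory.
Import numFieldNormedType.Exports.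

Set Implicit Arguments.
Unset Strict Implicit.
Unset Printing Implicit Defensive.

Local Open Scope classical_set_scope.
Local Open Scope ring_scope.

Definition vmul {R : realType} {N : nat} (u v : 'cV[R]_N) : 'cV[R]_N :=
  map2_mx *%R u v.
Definition vpow {R : realType} {N : nat} (u : 'cV[R]_N) (k : nat) : 'cV[R]_N :=
  map_mx (fun a => a ^+ k) u.
Definition vsqrt {R : realType} {N : nat} (u : 'cV[R]_N) : 'cV[R]_N :=
  map_mx Num.sqrt u.
Definition vpos {R : realType} {N : nat} (u : 'cV[R]_N) : Prop :=
  forall j, 0 < u j 0.
Definition vones {R : realType} {N : nat} : 'cV[R]_N := const_mx 1.

Notation "u ⊙ v" := (vmul u v) (at level 40, left associativity) : ring_scope.
Notation "u ⊙^ k" := (vpow u k) (at level 30) : ring_scope.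

Definition qform {R : realType} {N : nat} (A : 'M[R]_N) (u : 'cV[R]_N) : R :=
  (u^T *m A *m u) 0 0.

Definition sym_posdef {R : realType} {N : nat} (M : 'M[R]_N) : Prop :=
  M^T = M /\ forall u : 'cV[R]_N, u != 0 -> 0 < qform M u.

(* Symmetry is not required here: for the matrix to which this is applied
   below it follows from the other axioms of upwind operators. *)
Definition neg_semidef {R : realType} {N : nat} (A : 'M[R]_N) : Prop :=
  forall u : 'cV[R]_N, qform A u <= 0.

Definition consistent {R : realType} {N : nat} (A : 'M[R]_N) : Prop :=
  A *m vones = 0.

(* The grid x is part of the data of an SBP operator, but no axiom constrains
   it. *)
Record periodic_sbp1 {R : realType} {N : nat} (x : 'cV[R]_N)
    (D1 M : 'M[R]_N) : Prop := PeriodicSBP1 {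
  sbp1_consistent : consistent D1;
  sbp1_mass : sym_posdef M;
  sbp1_parts : M *m D1 + D1^T *m M = 0 }.

Record periodic_upwind_sbp1 {R : realType} {N : nat} (x : 'cV[R]_N)
    (Dp Dm M : 'M[R]_N) : Prop := PeriodicUpwindSBP1 {
  upwind_consistent_plus : consistent Dp;
  upwind_consistent_minus : consistent Dm;
  upwind_mass : sym_posdef M;
  upwind_parts : M *m Dp + Dm^T *m M = 0;
  upwind_dissipation : neg_semidef (2^-1 *: (M *m (Dp - Dm))) }.

Record periodic_sbp2 {R : realType} {N : nat} (x : 'cV[R]_N)
    (D2 M : 'M[R]_N) : Prop := PeriodicSBP2 {
  sbp2_consistent : consistent D2;
  sbp2_mass : sym_posdef M;
  sbp2_parts : M *m D2 = D2^T *m M }.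

Record sk_coefficients {R : realType} {N : nat} (g eta0 : R) (b : 'cV[R]_N)
    (alphat betat gammat : R) (alphah betah gammah : 'cV[R]_N) : Prop :=
  SKCoefficients {
  sk_depth : vpos (eta0 *: vones - b);
  sk_alphat : 0 <= alphat;
  sk_alphah : alphah ⊙^ 2 =
    alphat *: (vsqrt (g *: (eta0 *: vones - b)) ⊙ (eta0 *: vones - b) ⊙^ 2);
  sk_betah : betah = betat *: (eta0 *: vones - b) ⊙^ 3;
  sk_gammah : gammah =
    gammat *: (vsqrt (g *: (eta0 *: vones - b)) ⊙ (eta0 *: vones - b) ⊙^ 3) }.

Definition ddt {R : realType} {N : nat} (u : R -> 'cV[R]_N) (t : R) :
    'cV[R]_N :=
  \col_j derive1 (fun s : R => u s j 0) t.

(* To be used for open J only: derivatives are two-sided. *)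
Definition C1_on {R : realType} {N : nat} (J : set R) (u : R -> 'cV[R]_N) :
    Prop :=
  forall (j : 'I_N) (t : R), J t ->
    derivable (fun s : R => u s j 0) t 1 /\
    {for t, continuous (derive1 (fun s : R => u s j 0))}.

Definition sk_y {R : realType} {N : nat} (Dp Dm : 'M[R]_N)
    (b alphah h : 'cV[R]_N) : 'cV[R]_N :=
  alphah ⊙ (Dm *m (alphah ⊙ (Dp *m (h + b)))).

Definition sk_h_rhs {R : realType} {N : nat} (D1 Dp Dm : 'M[R]_N)
    (b alphah h v : 'cV[R]_N) : 'cV[R]_N :=
  - (D1 *m (h ⊙ v)) + Dm *m sk_y Dp Dm b alphah h.

Definition sk_hv_rhs {R : realType} {N : nat} (D1 Dp Dm D2 : 'M[R]_N) (g : R)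
    (b alphah betah gammah h v vt : 'cV[R]_N) : 'cV[R]_N :=
  let y := sk_y Dp Dm b alphah h in
  - (2^-1 *: (D1 *m (h ⊙ v ⊙^ 2) + h ⊙ v ⊙ (D1 *m v) + v ⊙ (D1 *m (h ⊙ v))))
  - g *: (h ⊙ (D1 *m (h + b)))
  + 2^-1 *: (Dm *m (v ⊙ y) + v ⊙ (Dm *m y) + y ⊙ (Dp *m v))
  + Dp *m (betah ⊙ (Dm *m vt))
  + 2^-1 *: (D2 *m (gammah ⊙ (D1 *m v)))
  + 2^-1 *: (D1 *m (gammah ⊙ (D2 *m v))).

Record sk_solution {R : realType} {N : nat} (D1 Dp Dm D2 : 'M[R]_N) (g : R)
    (b alphah betah gammah : 'cV[R]_N) (J : set R) (h v : R -> 'cV[R]_N) :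
    Prop := SKSolution {
  sk_h_C1 : C1_on J h;
  sk_v_C1 : C1_on J v;
  sk_h_pos : forall t, J t -> vpos (h t);
  sk_h_eq : forall t, J t -> ddt h t = sk_h_rhs D1 Dp Dm b alphah (h t) (v t);
  sk_hv_eq : forall t, J t ->
    ddt (fun s => h s ⊙ v s) t =
    sk_hv_rhs D1 Dp Dm D2 g b alphah betah gammah (h t) (v t) (ddt v t) }.

Definition mass_sum {R : realType} {N : nat} (M : 'M[R]_N) (u : 'cV[R]_N) : R :=
  (vones^T *m M *m u) 0 0.

(* The dispersive part 1/2 betah (A v)^2 of the modified entropy has to use the
   operator A = D_{1,-} that acts on v_t inside D_{1,+}(betah D_{1,-} v_t): by
   M D_{1,+} + D_{1,-}^T M = 0,
     v^T M D_{1,+}(betah D_{1,-} v_t) = - (D_{1,-} v)^T M (betah D_{1,-} v_t),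
   which is minus the time derivative of 1^T M (1/2 betah (D_{1,-} v)^2).
   With A = D_1 instead, the entropy inequality fails in general. *)
Definition modified_entropy {R : realType} {N : nat} (M A : 'M[R]_N) (g : R)
    (b betah h v : 'cV[R]_N) : R :=
  mass_sum M (2^-1 *: (h ⊙ v ⊙^ 2 + g *: h ⊙^ 2) + g *: (h ⊙ b)
           + 2^-1 *: (betah ⊙ (A *m v) ⊙^ 2)).

Definition conserved_on {R : realType} (J : set R) (F : R -> R) : Prop :=
  forall t, J t -> is_derive t 1 F 0.

Definition dissipated_on {R : realType} (J : set R) (F : R -> R) : Prop :=
  forall t, J t -> derivable F t 1 /\ derive1 F t <= 0.

(* Main.v *)
(* Testing the equations against 1 and v in the M-inner product, summation by
   parts moves every derivative operator off one factor. The split forms pair up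
   to cancel, and the term D_{1,+}(betah D_{1,-} v_t) becomes minus the time
   derivative of 1/2 betah (D_{1,-} v)^2. What remains of the entropy rate is
   - g w^T M D_{1,-} w with w = alphah D_{1,+}(h + b), which the upwind axiom
   makes nonpositive. *)
Require Import Defs.
From HB Require Import structures.
From mathcomp Require Import all_boot all_order all_algebra.
From mathcomp Require Import all_classical all_reals all_analysis.
From mathcomp Require Import ring lra.
Import Order.TTheory GRing.Theory Num.Theory.
Import numFieldNormedType.Exports.

Local Open Scope classical_set_scope.
Local Open Scope ring_scope.

(** * Componentwise multiplication: a commutative bilinear product with unit [vones] *)

Section ComponentwiseProduct.
Context {R : realType} {N : nat}.
Implicit Types u v w : 'cV[R]_N.

Lemma vmulC u v : u ⊙ v = v ⊙ u.
Proof. by apply/matrixP => i j; rewrite !mxE mulrC. Qed.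

Lemma vmulA u v w : u ⊙ (v ⊙ w) = u ⊙ v ⊙ w.
Proof. by apply/matrixP => i j; rewrite !mxE mulrA. Qed.

Lemma vmulDl u v w : (u + v) ⊙ w = u ⊙ w + v ⊙ w.
Proof. by apply/matrixP => i j; rewrite !mxE mulrDl. Qed.

Lemma vmulDr u v w : u ⊙ (v + w) = u ⊙ v + u ⊙ w.
Proof. by apply/matrixP => i j; rewrite !mxE mulrDr. Qed.

Lemma vmulNr u v : u ⊙ - v = - (u ⊙ v).
Proof. by apply/matrixP => i j; rewrite !mxE mulrN. Qed.

Lemma vmulZr a u v : u ⊙ (a *: v) = a *: (u ⊙ v).
Proof. by apply/matrixP => i j; rewrite !mxE mulrCA. Qed.

Lemma vmul1 u : vones ⊙ u = u.
Proof. by apply/matrixP => i j; rewrite !mxE mul1r. Qed.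

Lemma vmul0 u : 0 ⊙ u = 0.
Proof. by apply/matrixP => i j; rewrite !mxE mul0r. Qed.

Lemma vmulr0 u : u ⊙ 0 = 0.
Proof. by rewrite vmulC vmul0. Qed.

Lemma vpow2 u : u ⊙^ 2 = u ⊙ u.
Proof. by apply/matrixP => i j; rewrite !mxE expr2. Qed.

End ComponentwiseProduct.

(** * The [M]-weighted sum as a linear form, and summation by parts *)

Section MassSum.
Context {R : realType} {N : nat}.
Implicit Types (M A B : 'M[R]_N) (u v w : 'cV[R]_N).

Lemma mass_sumD M u v : mass_sum M (u + v) = mass_sum M u + mass_sum M v.
Proof. by rewrite /mass_sum mulmxDr mxE. Qed.

Lemma mass_sumN M u : mass_sum M (- u) = - mass_sum M u.
Proof. by rewrite /mass_sum mulmxN mxE. Qed.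

Lemma mass_sumZ M a u : mass_sum M (a *: u) = a * mass_sum M u.
Proof. by rewrite /mass_sum -scalemxAr mxE. Qed.

(** Diagonality of [M] enters here: both sides reduce to the sum of [M i i * u i 0 * w i 0], so
    matrix identities become usable under [mass_sum]. *)
Lemma mass_sum_vmul M u w : is_diag_mx M ->
  mass_sum M (u ⊙ w) = (u^T *m M *m w) 0 0.
Proof.
move=> /is_diag_mxP Md; rewrite /mass_sum !mxE; apply: eq_bigr => i _.
rewrite !mxE mulrA; congr (_ * _).
rewrite (bigD1 i) //= [RHS](bigD1 i) //= !big1 => [|j ji|j ji].
- by rewrite !addr0 !mxE mul1r mulrC.
- by rewrite Md ?mulr0.
- by rewrite Md ?mulr0.
Qed.

(** One adjoint rule for all operators: [B] is [D1] for [A = D1], [Dm] for [A = Dp], and [- D2] for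
    [A = D2]. *)
Lemma mass_sum_parts M A B u w : is_diag_mx M -> M *m A + B^T *m M = 0 ->
  mass_sum M (u ⊙ (A *m w)) = - mass_sum M ((B *m u) ⊙ w).
Proof.
move=> Md /eqP; rewrite addr_eq0 => /eqP MA.
rewrite !mass_sum_vmul // trmx_mul !mulmxA -(mulmxA u^T) MA.
by rewrite mulmxN mulNmx mxE mulmxA.
Qed.

Lemma mass_sum_diff0 M A B u : is_diag_mx M -> M *m A + B^T *m M = 0 ->
  consistent B -> mass_sum M (A *m u) = 0.
Proof.
move=> Md MA B1; rewrite -[A *m u]vmul1 (mass_sum_parts M A B _ _ Md MA) B1 vmul0.
by rewrite -[0](scale0r 0) mass_sumZ mul0r oppr0.
Qed.

End MassSum.

(** * Calculus of vector-valued functions of time *)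

Section VectorDerivatives.
Context {R : realType} {N : nat}.
Implicit Types (u w : R -> 'cV[R]_N) (t : R).

(** Couples differentiability with the value of the derivative, since [ddt] is total and by itself
    asserts no differentiability. *)
Definition is_vderive t u (du : 'cV[R]_N) : Prop :=
  forall j, is_derive t (1 : R) (fun s => u s j 0) (du j 0).

Lemma is_vderive_ddt J u t : C1_on J u -> J t -> is_vderive t u (ddt u t).
Proof.
move=> uJ Jt j; have [du _] := uJ j t Jt.
by rewrite mxE derive1E; apply: derivableP.
Qed.

Lemma ddt_is_vderive t u du : is_vderive t u du -> ddt u t = du.
Proof.
move=> hu; apply/matrixP => j k; rewrite mxE derive1E ord1.
by have := hu j; case=> _ ->.
Qed.

Lemma is_vderive_cst t (c : 'cV[R]_N) : is_vderive t (fun=> c) 0.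
Proof. by move=> j; rewrite mxE; exact: is_derive_cst. Qed.

Lemma is_vderiveD t u w du dw : is_vderive t u du -> is_vderive t w dw ->
  is_vderive t (fun s => u s + w s) (du + dw).
Proof.
move=> hu hw j; rewrite mxE; under eq_fun do rewrite mxE.
by have := hu j; have := hw j => ? ?; apply: is_deriveD.
Qed.

Lemma is_vderiveZ t a u du : is_vderive t u du ->
  is_vderive t (fun s => a *: u s) (a *: du).
Proof.
move=> hu j; rewrite mxE; under eq_fun do rewrite mxE.
by have := hu j => ?; apply: is_deriveZ.
Qed.

Lemma is_vderiveM t u w du dw : is_vderive t u du -> is_vderive t w dw ->
  is_vderive t (fun s => u s ⊙ w s) (u t ⊙ dw + w t ⊙ du).
Proof.
move=> hu hw j; rewrite !mxE; under eq_fun do rewrite mxE.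
by have := hu j; have := hw j => ? ?; apply: is_deriveM.
Qed.

Lemma is_vderive_sqr t u du : is_vderive t u du ->
  is_vderive t (fun s => u s ⊙^ 2) (2 *: (u t ⊙ du)).
Proof.
move=> hu; under eq_fun do rewrite vpow2.
by rewrite scaler_nat mulr2n; apply: is_vderiveM.
Qed.

(** [A] is rectangular so as to cover both the square operators and the row [vones^T *m M] of
    [mass_sum]. *)
Lemma is_derive_mulmx m (A : 'M[R]_(m, N)) t u du i : is_vderive t u du ->
  is_derive t (1 : R) (fun s => (A *m u s) i 0) ((A *m du) i 0).
Proof.
move=> hu; rewrite mxE; under eq_fun do rewrite mxE.
rewrite (_ : (fun _ => _) = \sum_(j < N) (fun s => A i j * u s j 0)).
  by apply: is_derive_sum => j; have := hu j => ?; apply: is_deriveZ.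
by apply/funext => s; rewrite fct_sumE.
Qed.

Lemma is_vderive_mulmx (A : 'M[R]_N) t u du : is_vderive t u du ->
  is_vderive t (fun s => A *m u s) (A *m du).
Proof. by move=> hu j; apply: is_derive_mulmx. Qed.

Lemma is_derive_mass_sum (M : 'M[R]_N) t u du : is_vderive t u du ->
  is_derive t (1 : R) (fun s => mass_sum M (u s)) (mass_sum M du).
Proof. exact: is_derive_mulmx. Qed.

End VectorDerivatives.

Arguments is_vderive_cst {R N} t c.
Arguments is_vderiveD {R N t u w du dw} _ _ _.
Arguments is_vderiveZ {R N t} a {u du} _ _.
Arguments is_vderiveM {R N t u w du dw} _ _ _.
Arguments is_vderive_sqr {R N t u du} _ _.
Arguments is_vderive_mulmx {R N} A {t u du} _ _.
Arguments is_derive_mass_sum {R N} M {t u du} _.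
Arguments ddt_is_vderive {R N t u du} _.

(** * Balance laws as algebraic identities, with no time dependence *)

Section SemidiscreteBalances.
Context {R : realType} {N : nat} (x : 'cV[R]_N) (M D1 Dp Dm D2 : 'M[R]_N).
Context (M_diag : is_diag_mx M) (upwindD : periodic_upwind_sbp1 x Dp Dm M).
Context (sbpD1 : periodic_sbp1 x D1 M) (sbpD2 : periodic_sbp2 x D2 M).
Context (g : R) (b alphah betah gammah : 'cV[R]_N).
Implicit Types (h v vt u w : 'cV[R]_N).

Lemma D1_parts u w :
  mass_sum M (u ⊙ (D1 *m w)) = - mass_sum M ((D1 *m u) ⊙ w).
Proof. by apply: mass_sum_parts M_diag _; case: sbpD1. Qed.

Lemma Dp_parts u w :
  mass_sum M (u ⊙ (Dp *m w)) = - mass_sum M ((Dm *m u) ⊙ w).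
Proof. by apply: mass_sum_parts M_diag _; case: upwindD. Qed.

Lemma Dm_parts u w :
  mass_sum M (u ⊙ (Dm *m w)) = - mass_sum M ((Dp *m u) ⊙ w).
Proof. by rewrite [in RHS]vmulC Dp_parts opprK vmulC. Qed.

Lemma D2_parts u w :
  mass_sum M (u ⊙ (D2 *m w)) = mass_sum M ((D2 *m u) ⊙ w).
Proof.
have [_ _ MD2] := sbpD2.
(* The symmetric relation for [D2] fits the skew rule with [B = - D2]; the two signs cancel. *)
rewrite (mass_sum_parts M D2 (- D2)) //.
  by rewrite mulNmx vmulC vmulNr mass_sumN opprK vmulC.
by rewrite MD2 linearN mulNmx subrr.
Qed.

(** Exposes a factor [vones], onto which summation by parts moves an operator that consistency then
    annihilates. *)
Lemma mass_sum_vones u : mass_sum M u = mass_sum M (vones ⊙ u).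
Proof. by rewrite vmul1. Qed.

Lemma mass_sum0 : mass_sum M 0 = 0.
Proof. by rewrite -(scale0r 0) mass_sumZ mul0r. Qed.

Lemma mass_sum_D1 w : mass_sum M (D1 *m w) = 0.
Proof.
by rewrite mass_sum_vones D1_parts (sbp1_consistent sbpD1) vmul0 mass_sum0 oppr0.
Qed.

Lemma mass_sum_Dp w : mass_sum M (Dp *m w) = 0.
Proof.
by rewrite mass_sum_vones Dp_parts (upwind_consistent_minus upwindD) vmul0
           mass_sum0 oppr0.
Qed.

Lemma mass_sum_Dm w : mass_sum M (Dm *m w) = 0.
Proof.
by rewrite mass_sum_vones Dm_parts (upwind_consistent_plus upwindD) vmul0
           mass_sum0 oppr0.
Qed.

Lemma mass_sum_D2 w : mass_sum M (D2 *m w) = 0.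
Proof.
by rewrite mass_sum_vones D2_parts (sbp2_consistent sbpD2) vmul0 mass_sum0.
Qed.

(* By summation by parts w^T M (Dp - Dm) w = - 2 w^T M Dm w. *)
Lemma mass_sum_Dm_ge0 w : 0 <= mass_sum M (w ⊙ (Dm *m w)).
Proof.
have := upwind_dissipation upwindD w.
rewrite /qform -scalemxAr -scalemxAl mxE (mulmxA w^T) -(mulmxA (w^T *m M)) -mass_sum_vmul //.
rewrite mulmxBl vmulDr vmulNr mass_sumD mass_sumN Dp_parts vmulC; lra.
Qed.

Lemma mass_rate h v : mass_sum M (sk_h_rhs D1 Dp Dm b alphah h v) = 0.
Proof.
by rewrite mass_sumD mass_sumN mass_sum_D1 mass_sum_Dm oppr0 addr0.
Qed.

(** Terms with an outermost operator sum to zero. By parts, [v ⊙ (D1 *m (h ⊙ v))] cancels its split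
    partner, and [v ⊙ (Dm *m y)] cancels [y ⊙ (Dp *m v)]. *)
Lemma discharge_rate b0 h v vt : b = b0 *: vones ->
  mass_sum M (sk_hv_rhs D1 Dp Dm D2 g b alphah betah gammah h v vt) = 0.
Proof.
move=> ->; rewrite /sk_hv_rhs; set y := sk_y _ _ _ _ _.
rewrite mulmxDr -scalemxAr (sbp1_consistent sbpD1) scaler0 addr0.
(* Skewness makes this number its own negative. *)
have hE : mass_sum M (h ⊙ (D1 *m h)) = 0.
  by have := D1_parts h h; rewrite [_ ⊙ h]vmulC; lra.
have hvE := D1_parts v (h ⊙ v); have yE := Dm_parts v y.
rewrite !(mass_sumD, mass_sumN, mass_sumZ).
rewrite !(mass_sum_D1, mass_sum_Dp, mass_sum_Dm, mass_sum_D2) hE hvE yE.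
rewrite [h ⊙ v ⊙ _]vmulC [y ⊙ _]vmulC; lra.
Qed.

(** The multipliers are the entropy variables: [v] for the momentum equation and
    [g (h + b) - v^2 / 2] for the mass equation. The [betah] term is the rate of the dispersive
    energy when [vt] is the time derivative of [v]. *)
Lemma entropy_rate h v vt : 0 <= g ->
  let ht := sk_h_rhs D1 Dp Dm b alphah h v in
  let hvt := sk_hv_rhs D1 Dp Dm D2 g b alphah betah gammah h v vt in
  mass_sum M (v ⊙ hvt) - 2^-1 * mass_sum M (v ⊙ v ⊙ ht)
  + g * mass_sum M ((h + b) ⊙ ht)
  + mass_sum M (betah ⊙ ((Dm *m v) ⊙ (Dm *m vt))) <= 0.
Proof.
move=> g_ge0 /=; rewrite /sk_h_rhs /sk_hv_rhs vpow2.
have E1 := D1_parts v (h ⊙ (v ⊙ v)).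
have E2 : v ⊙ (h ⊙ v ⊙ (D1 *m v)) = (D1 *m v) ⊙ (h ⊙ (v ⊙ v)).
  by apply/matrixP => i j; rewrite !mxE; ring.
(* The work of the pressure term cancels the flux [D1 *m (h ⊙ v)] tested against [g (h + b)]. *)
have E4 : mass_sum M (v ⊙ (h ⊙ (D1 *m (h + b)))) =
          - mass_sum M ((h + b) ⊙ (D1 *m (h ⊙ v))).
  by rewrite vmulA (vmulC v) D1_parts vmulC.
have E11 : mass_sum M ((h + b) ⊙ (Dm *m sk_y Dp Dm b alphah h)) <= 0.
  rewrite Dm_parts /sk_y vmulA (vmulC _ alphah).
  by rewrite oppr_le0 mass_sum_Dm_ge0.
(* Only the sign in [E11] depends on the form of [y]; the other cancellations hold for arbitrary
   [y]. *)
set y := sk_y _ _ _ _ _ in E11 *.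
have E5 := Dm_parts v (v ⊙ y).
have E7 : v ⊙ (y ⊙ (Dp *m v)) = (Dp *m v) ⊙ (v ⊙ y).
  by apply/matrixP => i j; rewrite !mxE; ring.
have E8 : mass_sum M (v ⊙ (Dp *m (betah ⊙ (Dm *m vt)))) =
          - mass_sum M (betah ⊙ ((Dm *m v) ⊙ (Dm *m vt))).
  by rewrite Dp_parts vmulA (vmulC _ betah) -vmulA.
(* [D2] is symmetric and [D1] skew for [M], so the two [gammah] terms have opposite signs and
   cancel. *)
have E9 := D2_parts v (gammah ⊙ (D1 *m v)).
have E10 : mass_sum M (v ⊙ (D1 *m (gammah ⊙ (D2 *m v)))) =
           - mass_sum M ((D2 *m v) ⊙ (gammah ⊙ (D1 *m v))).
  by rewrite D1_parts vmulC -vmulA vmulC -vmulA (vmulC (D1 *m v)) vmulA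
             (vmulC _ gammah) -vmulA.
(* The only contribution that survives; the product with [g] is formed beforehand because [lra] is
   linear. *)
have := mulr_ge0_le0 g_ge0 E11.
rewrite !(vmulDr, vmulNr, vmulZr) !(mass_sumD, mass_sumN, mass_sumZ).
rewrite E1 E2 E4 E5 E7 E8 E9 E10 !vmulA; lra.
Qed.

Lemma sk_y_lake_at_rest h c : h + b = c *: vones -> sk_y Dp Dm b alphah h = 0.
Proof.
move=> hb; rewrite /sk_y hb -scalemxAr (upwind_consistent_plus upwindD).
by rewrite scaler0 vmulr0 mulmx0 vmulr0.
Qed.

Lemma sk_h_rhs_lake_at_rest h c : h + b = c *: vones ->
  sk_h_rhs D1 Dp Dm b alphah h 0 = 0.
Proof.
move=> hb; rewrite /sk_h_rhs (sk_y_lake_at_rest h c hb).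
by rewrite vmulr0 !mulmx0 oppr0 addr0.
Qed.

(** Consistency of [D1] removes the pressure term; every other term contains [v], [vt] or the
    vanishing [y]. *)
Lemma sk_hv_rhs_lake_at_rest h c : h + b = c *: vones ->
  sk_hv_rhs D1 Dp Dm D2 g b alphah betah gammah h 0 0 = 0.
Proof.
move=> hb; rewrite /sk_hv_rhs (sk_y_lake_at_rest h c hb) hb -scalemxAr.
rewrite (sbp1_consistent sbpD1) vpow2.
by rewrite !(vmulr0, vmul0, mulmx0, scaler0, addr0, oppr0).
Qed.

End SemidiscreteBalances.

Theorem theorem3p12 (R : realType) (N : nat)
    (x : 'cV[R]_N) (M D1 Dp Dm D2 : 'M[R]_N)
    (M_diag : is_diag_mx M)
    (upwindD : periodic_upwind_sbp1 x Dp Dm M)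
    (sbpD1 : periodic_sbp1 x D1 M)
    (sbpD2 : periodic_sbp2 x D2 M)
    (g eta0 : R) (g_gt0 : 0 < g) (b : 'cV[R]_N)
    (alphat betat gammat : R) (alphah betah gammah : 'cV[R]_N)
    (coefs : sk_coefficients g eta0 b alphat betat gammat alphah betah gammah) :
  (forall (J : set R) (h v : R -> 'cV[R]_N),
     open J -> is_interval J ->
     sk_solution D1 Dp Dm D2 g b alphah betah gammah J h v ->
     [/\ conserved_on J (fun t => mass_sum M (h t)),
         (exists b0 : R, b = b0 *: vones) ->
           conserved_on J (fun t => mass_sum M (h t ⊙ v t))
       & dissipated_on J (fun t => modified_entropy M Dm g b betah (h t) (v t))])
  /\
  (forall (h0 : 'cV[R]_N) (c : R),
     h0 + b = c *: vones -> vpos h0 ->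
     sk_solution D1 Dp Dm D2 g b alphah betah gammah setT
       (fun _ : R => h0) (fun _ : R => 0)).
Proof.
have g_ge0 := ltW g_gt0.
split=> [J h v _ _ [hJ vJ _ h_eq hv_eq]|h0 c hb h0_pos].
  have hD t Jt := is_vderive_ddt J h t hJ Jt.
  have vD t Jt := is_vderive_ddt J v t vJ Jt.
  split=> [t Jt|[b0 b_cst] t Jt|t Jt].
  - rewrite -(mass_rate x M D1 Dp Dm M_diag upwindD sbpD1 b alphah (h t) (v t)).
    by rewrite -h_eq //; apply: is_derive_mass_sum; apply: hD.
  - rewrite -(discharge_rate x M D1 Dp Dm D2 M_diag upwindD sbpD1 sbpD2 g b
                alphah betah gammah b0 (h t) (v t) (ddt v t) b_cst).
    rewrite -hv_eq //; apply: is_derive_mass_sum.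
    (* The momentum equation only fixes the value of [ddt]; the product rule supplies
       differentiability of [h ⊙ v]. *)
    have hvD := is_vderiveM (hD t Jt) (vD t Jt).
    by rewrite (ddt_is_vderive hvD).
  have hvD := is_vderiveM (hD t Jt) (vD t Jt).
  have := entropy_rate x M D1 Dp Dm D2 M_diag upwindD sbpD1 sbpD2 g b alphah
    betah gammah (h t) (v t) (ddt v t) g_ge0.
  (* With [(h v)_t = h v_t + v h_t], the kinetic part becomes [h v v_t + v^2 h_t / 2], the
     derivative of [h v^2 / 2]. *)
  rewrite -h_eq // -hv_eq // (ddt_is_vderive hvD) => rate_le0.
  have DmvD := is_vderive_mulmx Dm (vD t Jt).
  (* The nesting follows the body of [modified_entropy], so the differentiated function agrees with
     it by conversion. *)
  have EhatD := is_derive_mass_sum M (is_vderiveD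
    (is_vderiveD
      (is_vderiveZ 2^-1 (is_vderiveD
        (is_vderiveM (hD t Jt) (is_vderive_sqr (vD t Jt)))
        (is_vderiveZ g (is_vderive_sqr (hD t Jt)))))
      (is_vderiveZ g (is_vderiveM (hD t Jt) (is_vderive_cst t b))))
    (is_vderiveZ 2^-1
      (is_vderiveM (is_vderive_cst t betah) (is_vderive_sqr DmvD)))).
  case: EhatD => EhatD Ehat'; split=> //; rewrite derive1E Ehat'.
  move: rate_le0 => /=.
  rewrite !(vmulr0, vmulDr, vmulDl, vmulZr, add0r, addr0) !vpow2.
  rewrite !(mass_sumD, mass_sumN, mass_sumZ).
  rewrite (vmulC b) !vmulA.
  (* [lra] treats weighted sums as atoms, so equal products need the same factor order. *)
  have -> : v t ⊙ h t ⊙ ddt v t = h t ⊙ v t ⊙ ddt v t by rewrite (vmulC (v t)).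
  lra.
have cst0 c0 t : ddt (fun=> c0 : 'cV[R]_N) t = 0.
  by rewrite (ddt_is_vderive (is_vderive_cst t c0)).
have cst_C1 (c0 : 'cV[R]_N) : C1_on setT (fun=> c0).
  move=> j t _; split; first exact: derivable_cst.
  rewrite (_ : derive1 _ = cst 0); first exact: cst_continuous.
  by apply/funext => s; rewrite derive1_cst.
split=> // t _; rewrite cst0.
  by rewrite (sk_h_rhs_lake_at_rest _ _ _ _ _ upwindD _ _ _ c hb).
(* [cst0] is applied a second time because [v_t] also occurs on the right-hand side of the momentum
   equation. *)
by rewrite cst0 (sk_hv_rhs_lake_at_rest x M D1 Dp Dm D2 upwindD sbpD1 g b
                   alphah betah gammah h0 c hb).
Qed.
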